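(* Let $\boldsymbol{W}_i=(W_{i1},\ldots,W_{ip})'\in\mathbb{R}^p$, $i\in[n]$, be independent random vectors, and put $S^{W}_{n,j}=\frac{1}{\sqrt n}\sum_{i=1}^n W_{ij}$ for $j\in[p]$. Suppose that $\mathbb{E}W_{ij}=0$ for each $i\in[n]$, $j\in[p]$, that $\frac1n\sum_{i=1}^n\mathbb{E}W_{ij}^2=\theta^2<\infty$ for each $j\in[p]$, and that $\sup_{i\in[n],j\in[p]}\mathbb{E}e^{t_1|W_{ij}|}<\infty$ for some $0<t_1<\infty$. Then there is a positive constant $C$ such that for all $z\in[C\sqrt{\log p},\,o(n^{1/6}(\log p)^{-1/3}))$, $$\mathbb{P}\Big(\max_{j\in[p]}|S^{W}_{n,j}|\le z\Big)\ \ge\ 1-2p\,\bar\Phi(z)\left(1+O(1)\frac{(z-(\log p)/p^3)^3\log p}{\sqrt n}\right)\left(1+\frac{O(1)\log p}{p^3\,\bar\Phi(z)}\right)-C\frac{n}{p^2}.$$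
   Context: $[n]=\{1,\ldots,n\}$ and $[p]=\{1,\ldots,p\}$. $\Phi$ is the cumulative distribution function of the standard normal distribution and $\bar\Phi(x)=1-\Phi(x)$. $A'$ denotes the transpose of $A$. The statement is asymptotic in the sample size $n$ and the dimension $p$: $O(1)$ stands for a positive finite constant; $b_n=o(a_n)$ means $\lim_{n\to\infty}b_n/a_n=0$, so the range of $z$ is from $C\sqrt{\log p}$ up to an upper endpoint that is of smaller order than $n^{1/6}(\log p)^{-1/3}$. The quantities $\theta$, $t_1$ and the bound on the exponential moments are fixed (they do not depend on $n,p$), and $C$ and the $O(1)$ constants do not depend on $n,p,z$. *)

(* Defs.v *)
From HB Require Import structures.
From mathcomp Require Import all_boot all_order all_algebra.
From mathcomp Require Import all_classical all_reals all_analysis.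

Set Implicit Arguments.
Unset Strict Implicit.
Unset Printing Implicit Defensive.

Import Order.TTheory GRing.Theory Num.Theory.
Import numFieldNormedType.Exports.

Local Open Scope classical_set_scope.
Local Open Scope ring_scope.

Section normal_cdf.
Context {R : realType}.

Definition Phi (x : R) : R := fine (normal_prob 0 1 `]-oo, x]).

Definition Phibar (x : R) : R := 1 - Phi x.

End normal_cdf.

(* With T' := p.-tuple R, whose sigma-algebra is generated by the coordinate
   projections (the Borel sets of R^p), this is independence of the vectors
   X i; the coordinates of a single X i may be dependent. *)
Definition mutually_independent {d d'} {T : measurableType d}
    {T' : measurableType d'} {R : realType} (P : probability T R)
    (I : finType) (X : I -> {RV P >-> T'}) : Prop :=
  forall (J : {set I}) (A : I -> set T'),
    (forall i, i \in J -> measurable (A i)) ->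
    P (\bigcap_(i in [set` J]) (X i @^-1` A i)) =
    (\prod_(i in J) P (X i @^-1` A i))%E.

Section normalized_sum.
Context {d} {T : measurableType d} {R : realType} {P : probability T R}.
Context {n p : nat}.
Variable W : 'I_n -> {RV P >-> p.-tuple R}.

Definition entry (i : 'I_n) (j : 'I_p) (w : T) : R := tnth (W i w) j.

Definition nsum (j : 'I_p) (w : T) : R :=
  (Num.sqrt n%:R)^-1 * \sum_(i < n) entry i j w.

(* The default value 0 is harmless: for p > 0 it does not affect the maximum
   of nonnegative numbers. *)
Definition max_abs_nsum (w : T) : R :=
  \big[Num.max/0]_(j < p) `|nsum j w|.

End normalized_sum.

(* The rate n^(1/6) (log p)^(-1/3).  For p = 1 the library's value is 0; since
   x / 0 = 0, every sequence is then o(rate), as it should be for a rate that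
   is formally infinite. *)
Definition rate {R : realType} (n p : nat) : R :=
  n%:R `^ (6^-1) * (ln p%:R) `^ (- 3^-1).

(* Main.v *)
(* The constant C governs both the lower end of the range of z and the remainder
   C n / p^2, so a Chernoff bound suffices.  The exponential moments give
   E exp(s W_ij) <= exp(kappa s^2) for |s| <= t1 / 2, with
   kappa = 16 |M| / t1^2.  Taking s = sqrt(log p / n) and z >= C sqrt(log p) with
   C = kappa + 3,
     P(|S_j| > z) <= 2 exp(kappa log p - z sqrt(log p)) <= 2 p^-3,
   and the union bound leaves 2 p^-2 <= C n / p^2; the Gaussian term of the
   claim is only used through its sign.  The choice of s is admissible because
   sqrt(log p) <= z < n^(1/6) (log p)^(-1/3) forces (log p)^5 < n. *)

Require Import Defs.
From mathcomp Require Import all_boot all_order all_algebra.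
From mathcomp Require Import all_classical all_reals all_analysis.
From mathcomp Require Import measurable_realfun lra ring.

Set Implicit Arguments.
Unset Strict Implicit.
Unset Printing Implicit Defensive.

Import Order.TTheory GRing.Theory Num.Theory.
Import numFieldNormedType.Exports.
Import HBNNSimple.

Local Open Scope classical_set_scope.
Local Open Scope ring_scope.

(** * Moment generating functions of centered variables *)

(** The inequality $e^{-x} \ge 1-x$ gives $e^x - 1 \le x e^x$, which leaves $x(e^x-1)$ to be
    bounded. For $x \ge 0$ the same inequality is used once more; for $x < 0$, multiplying $e^x - 1
    \ge x$ by $x$ bounds it by $x^2$. *)
Lemma expR_le_quadratic {R : realType} (x : R) :
  expR x <= 1 + x + x ^+ 2 * expR `|x|.
Proof.
have subx : expR x - 1 <= x * expR x.
  have := expR_ge1Dx (- x); rewrite -(ler_pM2r (expR_gt0 x)).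
  by rewrite -expRD addNr expR0; lra.
suff : x * (expR x - 1) <= x ^+ 2 * expR `|x| by lra.
have [x0|x0] := leP 0 x.
  by rewrite ger0_norm// expr2 -mulrA ler_wpM2l.
have e1 : 1 <= expR `|x| by rewrite -expR0 ler_expR.
apply: (@le_trans _ _ (x ^+ 2)); last by rewrite ler_peMr// sqr_ge0.
by rewrite expr2 ler_nM2l//; have := expR_ge1Dx x; lra.
Qed.

Lemma expR_norm_integrable {d} {T : measurableType d} {R : realType}
    {P : probability T R} (Y : T -> R) (t1 M : R) :
  measurable_fun [set: T] Y ->
  ('E_P[fun w => expR (t1 * `|Y w|)] <= M%:E)%E ->
  P.-integrable [set: T] (EFin \o (fun w => expR (t1 * `|Y w|))).
Proof.
move=> mY YM; apply/integrableP; split.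
  by apply/measurable_EFinP/measurableT_comp => //; apply: measurable_funM => //;
    exact: measurableT_comp.
rewrite expectation.unlock in YM; apply: le_lt_trans (ltry M).
by under eq_integral do rewrite /= ger0_norm ?expR_ge0//.
Qed.

(** Expand $e^{sY}$ to second order: centering kills the linear term, the remainder is at most a
    multiple of the exponential moment, and $1 + x \le e^x$ concludes. Writing [|M|] keeps the
    constant nonnegative with no sign assumption on [M]. *)
Lemma mgf_centered_le {d} {T : measurableType d} {R : realType}
    {P : probability T R} (Y : T -> R) (t1 M s : R) :
  0 < t1 -> `|s| <= t1 / 2 -> measurable_fun [set: T] Y ->
  ('E_P[Y] = 0)%E ->
  ('E_P[fun w => expR (t1 * `|Y w|)] <= M%:E)%E ->
  ('E_P[fun w => expR (s * Y w)] <= (expR (16 * `|M| / t1 ^+ 2 * s ^+ 2))%:E)%E.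
Proof.
move=> t10 st mY EY0 EYM.
have iexp := expR_norm_integrable mY EYM.
have msY : measurable_fun [set: T] (fun w => expR (s * Y w)).
  by apply: measurableT_comp => //; exact: measurable_funM.
have u_le u : u <= expR u :> R by have := expR_ge1Dx u; lra.
have iY : P.-integrable [set: T] (EFin \o Y).
  apply: (@le_integrable _ _ _ _ _ _ _
    (EFin \o (fun w => t1^-1 * expR (t1 * `|Y w|)))) => //=.
  - exact/measurable_EFinP.
  - move=> w _; rewrite lee_fin [leRHS]ger0_norm; last first.
      by rewrite pmulr_rge0 ?invr_gt0 ?expR_ge0.
    by rewrite ler_pdivlMl ?u_le.
  - exact: (@integrableZl _ _ _ _ _ measurableT t1^-1 _ iexp).
(* The exponent $t_1|Y|$ is split in two halves. One pays for the square, as $(t_1|Y|/4)^2 \le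
   e^{t_1|Y|/2}$; the other dominates $e^{|sY|}$, as $|s| \le t_1/2$. The factor [k] is what turns
   $(t_1|Y|/4)^2$ into $(sY)^2$. *)
pose k := 16 / t1 ^+ 2 * s ^+ 2.
have k0 : 0 <= k by rewrite mulr_ge0 ?sqr_ge0// divr_ge0 ?sqr_ge0.
have pointwise w : expR (s * Y w) <= 1 + s * Y w + k * expR (t1 * `|Y w|).
  apply: le_trans (expR_le_quadratic _) _; rewrite lerD2l.
  have sq_le : (t1 * `|Y w| / 4) ^+ 2 <= expR (t1 / 2 * `|Y w|).
    have -> : t1 / 2 * `|Y w| = (t1 * `|Y w| / 4) * 2 by field.
    rewrite expRM_natr ler_sqr ?nnegrE ?expR_ge0 ?u_le//.
    by apply: divr_ge0 => //; apply: mulr_ge0 => //; exact: ltW.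
  have -> : (s * Y w) ^+ 2 = k * (t1 * `|Y w| / 4) ^+ 2.
    by rewrite /k !exprMn real_normK ?num_real//; field; lra.
  rewrite -[leLHS]mulrA; apply: ler_wpM2l => //.
  have -> : expR (t1 * `|Y w|) = expR (t1 / 2 * `|Y w|) * expR (t1 / 2 * `|Y w|).
    by rewrite -expRD; congr expR; field.
  by rewrite ler_pM ?sqr_ge0 ?expR_ge0// normrM ler_expR ler_wpM2r.
have isY : P.-integrable [set: T] (EFin \o (fun w => s * Y w)).
  exact: (@integrableZl _ _ _ _ _ measurableT s (EFin \o Y)).
have ikE : P.-integrable [set: T] (EFin \o (fun w => k * expR (t1 * `|Y w|))).
  exact: (@integrableZl _ _ _ _ _ measurableT k
    (EFin \o (fun w => expR (t1 * `|Y w|)))).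
have i1 : P.-integrable [set: T] (EFin \o cst (1 : R)).
  exact: finite_measure_integrable_cst.
have i1sY : P.-integrable [set: T] (EFin \o (cst 1 \+ (fun w => s * Y w))).
  by have := integrableD measurableT i1 isY.
apply: (@le_trans _ _ (1 + k * `|M|)%:E); last first.
  have -> : 16 * `|M| / t1 ^+ 2 * s ^+ 2 = k * `|M| by rewrite /k; ring.
  by rewrite lee_fin expR_ge1Dx.
have upper : ('E_P[fun w => expR (s * Y w)] <=
    \int[P]_w ((1 + s * Y w + k * expR (t1 * `|Y w|))%:E))%E.
  rewrite expectation.unlock; apply: ge0_le_integral => //=.
  - by apply/measurable_EFinP.
  - by have /integrableP[] := integrableD measurableT i1sY ikE.
  - by move=> w _; rewrite lee_fin.
apply: le_trans upper _.
rewrite (@integralD_EFin _ _ _ _ _ measurableT _ _ i1sY ikE).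
rewrite (@integralD_EFin _ _ _ _ _ measurableT _ _ i1 isY).
rewrite /= integral_cst// [X in (1 * X)%E](@probability_setT _ _ _ P) mule1.
have -> : (\int[P]_x (s * Y x)%:E)%E = 0%E.
  rewrite (@integralZl _ _ _ _ _ measurableT _ iY).
  by move: EY0; rewrite expectation.unlock => ->; rewrite mule0.
rewrite adde0 EFinD leeD2l// (@integralZl _ _ _ _ _ measurableT _ iexp).
rewrite [leRHS]EFinM; apply: lee_wpmul2l; first by rewrite lee_fin.
by rewrite expectation.unlock in EYM; apply: le_trans EYM _; rewrite lee_fin ler_norm.
Qed.

(** * Expectations of products of independent factors *)

Section expectation_product.
Context {d d'} {T : measurableType d} {T' : measurableType d'} {R : realType}
  {P : probability T R}.

(** From indicators to simple functions by linearity, then to [f] by monotone convergence. The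
    expectation of [f \o X] may be infinite; finiteness of that of [Y] makes multiplication by it
    continuous in the limit. *)
Lemma expectation_mul_ge0 (X : {mfun T >-> T'}) (Y : T -> R) :
  measurable_fun [set: T] Y -> (forall w, 0 <= Y w) ->
  ('E_P[Y] < +oo)%E ->
  (forall A, measurable A ->
    'E_P[fun w => (\1_A (X w) * Y w)%R] = 'E_P[\1_A \o X] * 'E_P[Y])%E ->
  forall f : T' -> R, measurable_fun [set: T'] f -> (forall x, 0 <= f x) ->
  ('E_P[fun w => (f (X w) * Y w)%R] = 'E_P[f \o X] * 'E_P[Y])%E.
Proof.
rewrite expectation.unlock => mY Y0 Yoo indep f mf f0.
have Yfin : (\int[P]_w (Y w)%:E)%E \is a fin_num.
  by rewrite ge0_fin_numE ?integral_ge0// => w _; rewrite lee_fin.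
have mEf : measurable_fun [set: T'] (EFin \o f) by exact/measurable_EFinP.
have simple (g : {nnsfun T' >-> R}) :
    (\int[P]_w (g (X w) * Y w)%:E = \int[P]_w (g (X w))%:E * \int[P]_w (Y w)%:E)%E.
  have m1 y : measurable_fun [set: T'] (\1_(g @^-1` [set y]) : T' -> R).
    by apply/measurable_indicP; rewrite -[_ @^-1` _]setTI; exact: measurable_funP.
  (* The absolute value makes [h y] nonnegative for every real [y], as the exchange of sum and
     integral requires; on the range of [g] it equals [y]. *)
  pose h y (x : T') : R := `|y| * \1_(g @^-1` [set y]) x.
  have mh y : measurable_fun [set: T'] (h y) by exact: measurable_funM.
  have h0 y x : 0 <= h y x by rewrite /h mulr_ge0// indicE.
  have gE x : g x = \sum_(y \in range g) h y x.
    rewrite fimfunE; apply: eq_fsbigr => y /set_mem[u _ <-].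
    by rewrite /h ger0_norm.
  (* A general weight [Z] covers both sides of the identity: [Y] for the joint expectation and
     [cst 1] for that of [g \o X]. The limit [gXY] below is stated with [Z] for the same reason. *)
  have hint (Z : T -> R) : measurable_fun [set: T] Z -> (forall w, 0 <= Z w) ->
      (\int[P]_w (g (X w) * Z w)%:E = \sum_(y \in range g)
         `|y|%:E * \int[P]_w (\1_(g @^-1` [set y]) (X w) * Z w)%:E)%E.
    move=> mZ Z0.
    under eq_integral => w _ do rewrite gE mulr_fsuml -fsumEFin//.
    rewrite ge0_integral_fsum//; last 2 first.
    - move=> y; apply/measurable_EFinP/measurable_funM => //.
      exact: measurableT_comp.
    - by move=> y w _; rewrite lee_fin mulr_ge0.
    apply: eq_fsbigr => y _.
    under eq_integral => w _ do rewrite /h -mulrA EFinM.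
    rewrite ge0_integralZl_EFin//.
    - by move=> w _; rewrite lee_fin mulr_ge0.
    - apply/measurable_EFinP/measurable_funM => //.
      exact: measurableT_comp.
  rewrite (hint _ mY Y0).
  have /= := hint (cst 1) (measurable_cst _) (fun=> ler01).
  under eq_integral do rewrite mulr1.
  move=> ->; rewrite ge0_mule_fsuml; last first.
    by move=> y; rewrite mule_ge0// integral_ge0// => w _; rewrite lee_fin mulr_ge0.
  apply: eq_fsbigr => y _; rewrite -muleA; congr (_ * _)%E.
  rewrite indep; last by apply/measurable_indicP.
  by congr (_ * _)%E; apply: eq_integral => w _; rewrite /= mulr1.
pose g := nnsfun_approx measurableT mEf.
have gf x : (g n x)%:E @[n --> \oo] --> (f x)%:E.
  by apply: cvg_nnsfun_approx => // y _; rewrite lee_fin.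
have gmon m n x : (m <= n)%N -> g m x <= g n x.
  by move=> mn; have /lefP := nd_nnsfun_approx measurableT mEf mn; exact.
have gXY (Z : T -> R) : measurable_fun [set: T] Z -> (forall w, 0 <= Z w) ->
    (\int[P]_w (g n (X w) * Z w)%:E)%E @[n --> \oo]
      --> (\int[P]_w (f (X w) * Z w)%:E)%E.
  move=> mZ Z0.
  rewrite [X in _ --> X](_ : _ =
      \int[P]_w limn (fun n => (g n (X w) * Z w)%:E))%E.
    apply: cvg_monotone_convergence => //.
    - move=> n; apply/measurable_EFinP/measurable_funM => //.
      exact: measurableT_comp.
    - by move=> n w _; rewrite lee_fin mulr_ge0.
    - by move=> w _ m n mn; rewrite lee_fin ler_wpM2r// gmon.
  apply: eq_integral => w _; apply/esym/cvg_lim => //.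
  under eq_fun do rewrite EFinM.
  by rewrite EFinM; apply: cvgeZr.
have lim1 := gXY _ mY Y0.
have := gXY (cst 1) (measurable_cst _) (fun=> ler01).
under eq_fun do under eq_integral do rewrite mulr1.
under eq_integral do rewrite mulr1.
move=> /(cvgeZr Yfin) lim2; apply: cvg_unique lim1 _ => //.
by rewrite /=; under eq_fun => n do rewrite (simple (g n)).
Qed.

(* The factors are indicators outside [s], so that induction on [s] starts from
   the independence of events and turns one indicator at a time into a general
   function. *)
Lemma expectation_prod_independent_on (I : finType) (X : I -> {RV P >-> T'})
    (s : seq I) (f : I -> T' -> R) :
  mutually_independent X ->
  (forall i, measurable_fun [set: T'] (f i)) -> (forall i x, 0 <= f i x) ->
  (forall i, 'E_P[f i \o X i] < +oo)%E ->
  (forall i, i \notin s -> exists2 A, measurable A & f i = \1_A) ->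
  ('E_P[fun w => (\prod_i f i (X i w))%R] = \prod_i 'E_P[f i \o X i])%E.
Proof.
move=> indX; elim: s f => [f mf f0 foo findic|k s ih f mf f0 foo findic].
  have /choice[A fA] : forall i, exists A, measurable A /\ f i = \1_A.
    by move=> i; have [A mA fA] := findic i isT; exists A.
  have mA i : measurable (A i) by case: (fA i).
  have fE i : f i = \1_(A i) by case: (fA i).
  rewrite expectation.unlock; have := indX finset.setT A (fun i _ => mA i).
  (* With every factor an indicator, their product is the indicator of the intersection of all the
     events. *)
  have -> : P (\bigcap_(i in [set` finset.setT]) (X i @^-1` A i)) =
      (\int[P]_w (\prod_i f i (X i w))%:E)%E.
    have mB : measurable (\bigcap_(i in [set` finset.setT]) (X i @^-1` A i)).
      apply: fin_bigcap_measurable => // i _.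
      by rewrite -[_ @^-1` _]setTI; exact: measurable_funP.
    rewrite -[X in P X]setIT -integral_indic//; apply: eq_integral => w _.
    congr EFin; rewrite indicE; under eq_bigr do rewrite fE indicE.
    rewrite -natr_prod; congr (_%:R).
    have [/forallP inA|] := boolP [forall i, X i w \in A i].
      rewrite big1 => [|i _]; last by rewrite inA.
      by rewrite mem_set// => i _; exact/set_mem/inA.
    rewrite negb_forall => /existsP[i niA].
    rewrite (bigD1 i)//= (negbTE niA) mul0n memNset// => inA.
    by move/negP: niA; apply; apply/mem_set/inA; rewrite /= inE.
  move=> ->; apply: eq_big => [i|i _]; first by rewrite inE.
  rewrite -[X in P X]setIT -integral_indic//; last first.
    by rewrite -[_ @^-1` _]setTI; exact: measurable_funP.
  by apply: eq_integral => w _; rewrite fE /= !indicE.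
have Ef0 i : (0 <= 'E_P[f i \o X i])%E.
  by rewrite expectation.unlock; apply: integral_ge0 => w _; rewrite lee_fin/=.
pose Y w := \prod_(i | i != k) f i (X i w).
have mY : measurable_fun [set: T] Y.
  rewrite /Y; under eq_fun do rewrite -big_filter.
  apply: measurable_prod => i _. exact: measurableT_comp.
(* Replacing [f k] by an indicator puts [k] among the indices allowed outside [s], so the induction
   hypothesis applies. This is the factorization over indicators that [expectation_mul_ge0] asks
   for. *)
have upd A : measurable A ->
  ('E_P[fun w => (\1_A (X k w) * Y w)%R] =
    'E_P[\1_A \o X k] * \prod_(i | i != k) 'E_P[f i \o X i])%E.
  move=> mA; pose h i := if i == k then \1_A else f i.
  have hk : h k = \1_A by rewrite /h eqxx.
  have hi i : i != k -> h i = f i by rewrite /h => /negbTE ->.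
  have := ih h; rewrite (bigD1 k)//= hk.
  have -> : (fun w => \prod_i h i (X i w)) = (fun w => \1_A (X k w) * Y w).
    apply/funext => w; rewrite (bigD1 k)//= hk; congr (_ * _).
    by apply: eq_bigr => i /hi ->.
  rewrite [X in (_ * X)%E](eq_bigr (fun i => ('E_P[f i \o X i])%E)) => [|i /hi ->//].
  apply => i.
  - by rewrite /h; case: ifP => // _; exact/measurable_indicP.
  - by move=> x; rewrite /h; case: ifP.
  - have [->|/hi ->//] := eqVneq i k; rewrite hk.
    rewrite expectation.unlock (_ : (fun x => _) = (fun w => (\1_(X k @^-1` A) w)%:E)).
      rewrite integral_indic//= ?setIT; last first.
        by rewrite -[_ @^-1` _]setTI; exact: measurable_funP.
      by rewrite -ge0_fin_numE// fin_num_measure// -[_ @^-1` _]setTI; exact: measurable_funP.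
    by apply/funext => w.
  - move=> nis; have [->|ik] := eqVneq i k; first by exists A.
    by rewrite hi//; apply: findic; rewrite inE negb_or ik.
(* The case where [A] is the whole space; it also yields the finiteness of the expectation of
   [Y]. *)
have YE : ('E_P[Y] = \prod_(i | i != k) 'E_P[f i \o X i])%E.
  have := upd _ measurableT.
  under eq_fun do rewrite indicT mul1r.
  move=> ->. rewrite (_ : _ \o _ = cst 1) ?expectation_cst ?mul1e//.
  by apply/funext => w; rewrite /= indicT.
rewrite (bigD1 k)//= -YE.
have -> : (fun w => \prod_i f i (X i w)) = (fun w => f k (X k w) * Y w).
  by apply/funext => w; rewrite (bigD1 k).
apply: expectation_mul_ge0 => //.
- by move=> w; apply: prodr_ge0.
- rewrite YE -ge0_fin_numE; last first.
    by apply: prode_ge0 => i _; exact: Ef0.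
  apply: prode_fin_num => i _; by rewrite ge0_fin_numE ?foo ?Ef0.
- by move=> A mA; rewrite YE upd.
Qed.

Lemma expectation_prod_independent (I : finType) (X : I -> {RV P >-> T'})
    (f : I -> T' -> R) :
  mutually_independent X ->
  (forall i, measurable_fun [set: T'] (f i)) -> (forall i x, 0 <= f i x) ->
  (forall i, 'E_P[f i \o X i] < +oo)%E ->
  ('E_P[fun w => (\prod_i f i (X i w))%R] = \prod_i 'E_P[f i \o X i])%E.
Proof.
move=> indX mf f0 foo.
apply: (expectation_prod_independent_on (s := enum I)) => // i.
by rewrite mem_enum.
Qed.

End expectation_product.

(** * Chernoff bound for independent sums *)

Section tail_bounds.
Context {d d'} {T : measurableType d} {T' : measurableType d'} {R : realType}
  {P : probability T R} {I : finType}.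

(** Markov's inequality for $e^{s(S-a)}$, whose expectation factors by independence. Keeping [s] on
    both sides of the event lets its sign select the upper or the lower tail. *)
Lemma chernoff_sum_independent (X : I -> {RV P >-> T'}) (g : T' -> R)
    (t1 M s a : R) :
  0 < t1 -> `|s| <= t1 / 2 ->
  mutually_independent X -> measurable_fun [set: T'] g ->
  (forall i, 'E_P[g \o X i] = 0)%E ->
  (forall i, 'E_P[fun w => expR (t1 * `|g (X i w)|)%R] <= M%:E)%E ->
  (P [set w | (s * a <= s * \sum_i g (X i w))%R] <=
    (expR (#|I|%:R * (16 * `|M| / t1 ^+ 2 * s ^+ 2) - s * a))%:E)%E.
Proof.
move=> t10 st indX mg Eg0 EgM.
set v := 16 * `|M| / t1 ^+ 2 * s ^+ 2.
have mgX i : measurable_fun [set: T] (fun w => g (X i w)).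
  exact: measurableT_comp.
have msum : measurable_fun [set: T] (fun w => \sum_i g (X i w)).
  exact: measurable_sum.
have mgf i : ('E_P[fun w => expR (s * g (X i w))%R] <= (expR v)%:E)%E.
  by apply: mgf_centered_le (EgM i) => //; exact: Eg0.
have mA : measurable [set w | s * a <= s * \sum_i g (X i w)].
  rewrite -[X in measurable X]setTI; apply: measurable_fun_le => //.
  exact: measurable_funM.
have expsum w : expR (s * (\sum_i g (X i w) - a)) =
    expR (- (s * a)) * \prod_i expR (s * g (X i w)).
  by rewrite -expR_sum -expRD -mulr_sumr; congr expR; ring.
have mexp : measurable_fun [set: T] (fun w => \prod_i expR (s * g (X i w))).
  apply: measurable_prod => i _; apply: measurableT_comp => //.
  exact: measurable_funM.
apply: (@le_trans _ _
    (\int[P]_w (expR (- (s * a)) * \prod_i expR (s * g (X i w)))%:E)%E).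
  rewrite -[X in P X]setIT -integral_indic//; apply: ge0_le_integral => //.
  - by apply/measurable_EFinP; exact/measurable_indicP.
  - by apply/measurable_EFinP; exact: measurable_funM.
  move=> w _; rewrite lee_fin -expsum indicE.
  have [/set_mem/= aw|_] := boolP (w \in _); last exact: expR_ge0.
  by rewrite -[leLHS]expR0 ler_expR mulrBr subr_ge0.
rewrite (eq_integral (fun w => (expR (- (s * a)))%:E *
    (\prod_i expR (s * g (X i w)))%:E)%E) => [|w _]; last by rewrite EFinM.
rewrite ge0_integralZl_EFin//; last 2 first.
- by move=> w _; rewrite lee_fin prodr_ge0// => i _; exact: expR_ge0.
- exact/measurable_EFinP.
have := @expectation_prod_independent _ _ _ _ _ P I X
  (fun _ x => expR (s * g x)) indX.
rewrite expectation.unlock => ->; last 3 first.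
- by move=> i; apply: measurableT_comp => //; exact: measurable_funM.
- by move=> i x; exact: expR_ge0.
- by move=> i; have := mgf i; rewrite expectation.unlock => /le_lt_trans ->//; rewrite ltry.
rewrite addrC expRD EFinM; apply: lee_wpmul2l; first by rewrite lee_fin expR_ge0.
rewrite mulr_natl -sumr_const expR_sum -prodEFin.
set lhs := (leLHS); set rhs := (leRHS).
(* Nonnegativity is carried through the induction because products of extended reals are monotone
   only for nonnegative factors. *)
suff /andP[] : (0 <= lhs <= rhs)%E by [].
rewrite /lhs /rhs; elim/big_ind2: _ => [|x y u v' /andP[x0 xy] /andP[u0 uv]|i _].
- by rewrite lee01 lexx.
- by rewrite mule_ge0//= lee_pmul.
apply/andP; split; first by apply: integral_ge0 => w _; rewrite lee_fin expR_ge0.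
by have := mgf i; rewrite expectation.unlock.
Qed.

End tail_bounds.

(** * The normal tail and the tails of the normalized coordinates *)

Lemma Phibar_ge0 {R : realType} (x : R) : 0 <= Phibar x.
Proof.
rewrite subr_ge0 -lee_fin fineK ?fin_num_measure//.
exact: probability_le1.
Qed.

Lemma measurable_nsum_gt {d} {T : measurableType d} {R : realType}
    {P : probability T R} (n p : nat) (W : 'I_n -> {RV P >-> p.-tuple R})
    (j : 'I_p) (z : R) :
  measurable [set w | z < `|nsum W j w|].
Proof.
rewrite (_ : mkset _ = ~` [set w | `|nsum W j w| <= z]); last first.
  by apply/seteqP; split=> w /=; rewrite ltNge => /negP.
apply: measurableC; rewrite -[X in measurable X]setTI.
apply: measurable_fun_le => //; apply: measurableT_comp => //.
apply: measurable_funM => //; apply: measurable_sum => i.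
exact: (measurableT_comp (measurable_tnth j)).
Qed.

(** Chernoff at $s = \pm u/\sqrt n$ and threshold $\pm\sqrt n\, z$: the sample size cancels from the
    exponent, and the factor 2 counts the two tails. *)
Lemma nsum_tail {d} {T : measurableType d} {R : realType} {P : probability T R}
    (n p : nat) (W : 'I_n -> {RV P >-> p.-tuple R}) (j : 'I_p) (t1 M u z : R) :
  (0 < n)%N -> 0 < t1 -> 0 <= u -> u / Num.sqrt n%:R <= t1 / 2 ->
  mutually_independent W ->
  (forall i, 'E_P[entry W i j] = 0)%E ->
  (forall i, 'E_P[fun w => expR (t1 * `|entry W i j w|)%R] <= M%:E)%E ->
  (P [set w | (z < `|nsum W j w|)%R] <=
    (2 * expR (16 * `|M| / t1 ^+ 2 * u ^+ 2 - u * z))%:E)%E.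
Proof.
move=> n0 t10 u0 ut indW EW0 EWM.
set v := expR _.
pose r : R := Num.sqrt n%:R.
have r0 : 0 < r by rewrite sqrtr_gt0 ltr0n.
have r2 : r ^+ 2 = n%:R by rewrite sqr_sqrtr.
pose g (x : p.-tuple R) := tnth x j.
have mg : measurable_fun [set: p.-tuple R] g by exact: measurable_tnth.
have msum : measurable_fun [set: T] (fun w => \sum_i g (W i w)).
  by apply: measurable_sum => i; exact: measurableT_comp mg _.
have s0 : 0 <= u / r by rewrite divr_ge0// ltW.
pose s := u / r.
have vE : expR (#|'I_n|%:R * (16 * `|M| / t1 ^+ 2 * s ^+ 2) - s * (r * z)) = v.
  rewrite card_ord -r2 /v /s; congr expR; field.
  by rewrite !gt_eqF.
have right_tail :
    (P [set w | (s * (r * z) <= s * \sum_i g (W i w))%R] <= v%:E)%E.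
  by rewrite -vE; apply: chernoff_sum_independent => //; rewrite ger0_norm.
(* Both [s] and the threshold change sign, which leaves $s^2$ and $sa$, hence the bound [v],
   unchanged. *)
have left_tail :
    (P [set w | (- s * (- (r * z)) <= - s * \sum_i g (W i w))%R] <= v%:E)%E.
  rewrite -vE -(sqrrN s) -[s * (r * z)]mulrNN.
  by apply: chernoff_sum_independent => //; rewrite normrN ger0_norm.
have -> : (2 * v)%:E = (v%:E + v%:E)%E by rewrite -EFinD; congr EFin; ring.
apply: le_trans (leeD right_tail left_tail).
have mle (a c : R) : measurable [set w | a <= c * \sum_i g (W i w)].
  rewrite -[X in measurable X]setTI; apply: measurable_fun_le => //.
  exact: measurable_funM.
apply: (@le_trans _ _ (P ([set w | s * (r * z) <= s * \sum_i g (W i w)] `|`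
    [set w | - s * (- (r * z)) <= - s * \sum_i g (W i w)]))); last exact: measureU2.
apply: le_measure; rewrite ?inE; [exact: measurable_nsum_gt|exact: measurableU|].
move=> w /=; rewrite /nsum -/r normrM gtr0_norm ?invr_gt0//.
rewrite ltr_pdivlMl// => /ltW; rewrite ler_normr => /orP[] rz; [left|right].
  by rewrite ler_wpM2l.
by rewrite !mulNr mulrN opprK -mulrN ler_wpM2l.
Qed.

(** * Growth of $\log p$ in the admissible range *)

(** Sixth powers clear all the roots: with $L = \log p > 0$ the hypothesis becomes $L^3 < n
    L^{-2}$. *)
Lemma ln_pow5_lt {R : realType} (n p : nat) : (1 < p)%N ->
  Num.sqrt (ln p%:R) < rate n p :> R -> (ln p%:R) ^+ 5 < n%:R :> R.
Proof.
move=> p1; set L : R := ln p%:R => Lrate.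
have L0 : 0 < L by rewrite ln_gt0// ltr1n.
have rate6 : (rate n p : R) ^+ 6 = n%:R * (L ^+ 2)^-1.
  have powRX (x y : R) : (x `^ y) ^+ 6 = x `^ (y * 6%:R).
    by rewrite powRrM powR_mulrn ?powR_ge0.
  rewrite /rate exprMn !powRX -/L.
  rewrite (_ : 6^-1 * 6%:R = 1); last by field.
  rewrite (_ : - 3^-1 * 6%:R = - 2%:R); last by field.
  by rewrite powRr1// powRN powR_mulrn// ltW.
have : Num.sqrt L ^+ 6 < rate n p ^+ 6 by rewrite ltr_pXn2r ?nnegrE ?mulr_ge0 ?powR_ge0.
rewrite rate6 (exprM _ 2 3) sqr_sqrtr ?(ltW L0)// ltr_pdivlMr ?exprn_gt0//.
by rewrite -exprD.
Qed.

(** * Union bound over the coordinates *)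

Theorem theorem2p2 (R : realType) (theta t1 M : R) (t1_gt0 : 0 < t1) :
  exists C K1 K2 : R, [/\ 0 < C, 0 < K1, 0 < K2 &
    forall (p : nat -> nat) (b : nat -> R),
      (forall n, (0 < p n)%N) ->
      (b n / rate n (p n) @[n --> \oo] --> (0 : R)) ->
      \forall n \near \oo,
        forall (d : measure_display) (T : measurableType d)
          (P : probability T R) (W : 'I_n -> {RV P >-> (p n).-tuple R}),
        mutually_independent W ->
        (forall i j, 'E_P[entry W i j] = 0)%E ->
        (forall j, (n%:R^-1)%:E * (\sum_(i < n) 'E_P[fun w => (entry W i j w ^+ 2)%R])
                   = (theta ^+ 2)%:E)%E ->
        (forall i j, 'E_P[fun w => expR (t1 * `|entry W i j w|)%R] <= M%:E)%E ->
        forall z : R,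
          C * Num.sqrt (ln (p n)%:R) <= z -> z < b n ->
          ((1 - 2 * (p n)%:R * Phibar z
                * (1 + K1 * ((z - ln (p n)%:R / (p n)%:R ^+ 3) ^+ 3 * ln (p n)%:R
                             / Num.sqrt n%:R))
                * (1 + K2 * ln (p n)%:R / ((p n)%:R ^+ 3 * Phibar z))
              - C * (n%:R / (p n)%:R ^+ 2))%:E
           <= P [set w | (max_abs_nsum W w <= z)%R])%E].
Proof.
pose kappa := 16 * `|M| / t1 ^+ 2.
have kappa0 : 0 <= kappa by rewrite divr_ge0 ?sqr_ge0// mulr_ge0.
have C0 : 0 < kappa + 3 by rewrite ltr_wpDl.
(* In [kappa + 3], the term [kappa] cancels the variance term of the exponent and 3 leaves $p^{-3}$
   for each coordinate. [K1] and [K2] enter only through the sign of a product, so any positive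
   values serve. *)
exists (kappa + 3), 1, 1; split => // p b p0 bo.
(* Squaring turns the condition $u/\sqrt n \le t_1/2$ into $L \le c\,n$. *)
pose c := (t1 / 2) ^+ 2.
have c0 : 0 < c by rewrite exprn_gt0// divr_gt0.
have bo1 : \forall n \near \oo, `|b n / rate n (p n)| < 1.
  by have := cvgr0_norm_lt _ bo; apply.
near=> n => d T P W indW EW0 _ EWM z Cz zb.
have n0 : (0 < n)%N by near: n; exact: nbhs_infty_gt.
have nc : (c ^+ 5)^-1 <= n%:R by near: n; exact: nbhs_infty_ger.
have bn : `|b n / rate n (p n)| < 1 by near: n.
set L : R := ln (p n)%:R in Cz *.
have pR : 1 <= (p n)%:R :> R by rewrite ler1n.
have L0 : 0 <= L by exact: ln_ge0.
set u := Num.sqrt L in Cz *.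
have u0 : 0 <= u by exact: sqrtr_ge0.
have u2 : u ^+ 2 = L by exact: sqr_sqrtr.
have n1 : 1 <= n%:R :> R by rewrite ler1n.
have uz : u <= z by apply: le_trans Cz; rewrite ler_peMl//; lra.
have z0 : 0 <= z by exact: le_trans uz.
have cn0 : 0 <= c * n%:R by exact: mulr_ge0 (ltW c0) (ler0n _ _).
(* For $p = 1$ the value 0 of [rate] gives no control of [b], but then $L = 0$. Otherwise $L^5 < n
   \le (cn)^5$, where the second inequality uses $n \ge c^{-5}$ and $n \ge 1$. *)
have Ln : L <= c * n%:R.
  have [p1|p1] := leqP (p n) 1.
    have pn1 : p n = 1%N by apply/eqP; rewrite eqn_leq p1 p0.
    by rewrite /L pn1 ln1 mulr_ge0// ltW.
  have rate0 : 0 < rate n (p n) :> R.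
    by rewrite mulr_gt0// powR_gt0 ?ltr0n// ln_gt0// ltr1n.
  have L5 : L ^+ 5 < n%:R.
    apply: ln_pow5_lt => //; apply: (le_lt_trans uz); apply: (lt_trans zb).
    have := le_lt_trans (ler_norm _) bn.
    by rewrite ltr_pdivrMr// mul1r.
  rewrite -(ler_pXn2r (n := 5))// ?nnegrE ?cn0//.
  apply: (le_trans (ltW L5)); rewrite exprMn.
  have cn1 : 1 <= c ^+ 5 * n%:R by rewrite mulrC -ler_pdivrMr ?div1r// exprn_gt0.
  rewrite [n%:R ^+ 5]exprSr mulrA ler_peMl//.
  apply: (le_trans cn1); apply: ler_wpM2l.
    by rewrite exprn_ge0// ltW.
  by rewrite exprSr ler_peMl// exprn_ege1.
have ut : u / Num.sqrt n%:R <= t1 / 2.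
  rewrite ler_pdivrMr ?sqrtr_gt0 ?ltr0n// -(ler_pXn2r (n := 2))// ?nnegrE ?mulr_ge0
    ?sqrtr_ge0 ?divr_ge0 ?(ltW t1_gt0)//.
  by rewrite u2 exprMn sqr_sqrtr.
have tail j : (P [set w | (z < `|nsum W j w|)%R] <= (2 / (p n)%:R ^+ 3)%:E)%E.
  have := nsum_tail z n0 t1_gt0 u0 ut indW (EW0^~ j) (EWM^~ j).
  move=> /le_trans; apply.
  rewrite lee_fin ler_wpM2l// -/kappa u2.
  apply: (@le_trans _ _ (expR (- (L * 3%:R)))); last first.
    by rewrite expRN expRM_natr /L lnK// posrE (lt_le_trans _ pR).
  by rewrite ler_expR; have := ler_wpM2l u0 Cz; rewrite -u2; lra.
have mB j := measurable_nsum_gt W j z.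
have union : (P (\bigcup_j [set w | (z < `|nsum W j w|)%R]) <=
    (2 / (p n)%:R ^+ 2)%:E)%E.
  apply: (@le_trans _ _ (\sum_(j < p n) (2 / (p n)%:R ^+ 3)%:E)%E).
    apply: (@le_trans _ _ (\sum_(j < p n) P [set w | (z < `|nsum W j w|)%R])%E).
      rewrite -big_enum/= fsbig_seq ?enum_uniq//.
      apply: content_sub_fsum => //.
        exact: fin_bigcup_measurable.
      by move=> w [j _ zj]; exists j => //=; rewrite mem_enum.
    exact: lee_sum.
  rewrite sumEFin sumr_const card_ord lee_fin -[leLHS]mulr_natr -mulrA ler_wpM2l//.
  by rewrite exprSr invfM -mulrA mulVf ?mulr1// gt_eqF// (lt_le_trans _ pR).
have -> : [set w | max_abs_nsum W w <= z] =
    ~` (\bigcup_j [set w | z < `|nsum W j w|]).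
  apply/seteqP; split=> w /=.
    move=> /bigmax_leP[_ le_z] [j _] /=.
    by rewrite ltNge le_z.
  (* The default 0 of the maximum must also be at most [z], which is [z0]. *)
  move=> nB; apply/bigmax_leP; split=> // j _.
  by rewrite leNgt; apply/negP => zj; apply: nB; exists j.
rewrite probability_setC; last by apply: fin_bigcup_measurable.
apply: (@le_trans _ _ (1 - 2 / (p n)%:R ^+ 2)%:E); last first.
  by rewrite EFinB; apply: leeB.
rewrite lee_fin -addrA lerD2l -opprD lerN2.
set A := 2 * _ * _ * _ * _.
(* Since $u \le 1 + u^2 = 1 + L \le e^L = p \le p^3$, one gets $L/p^3 = u \cdot u/p^3 \le u \le z$;
   the cube in the Gaussian term is thus nonnegative. *)
have zL : 0 <= z - L / (p n)%:R ^+ 3.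
  rewrite subr_ge0; apply: le_trans uz.
  rewrite ler_pdivrMr ?exprn_gt0 ?(lt_le_trans _ pR)// -u2 expr2 ler_wpM2l//.
  have uL : u <= 1 + L by rewrite -u2; have := sqr_ge0 (u - 1); have := sqr_ge0 u; lra.
  have Lp : 1 + L <= (p n)%:R.
    rewrite -[leRHS]lnK ?posrE ?(lt_le_trans _ pR)//; exact: expR_ge1Dx.
  by apply: (le_trans uL); apply: (le_trans Lp); rewrite exprS ler_peMr// exprn_ege1.
(* Nonnegativity of [Phibar z] suffices even in the denominator, since the inverse of 0 is 0. *)
have A0 : 0 <= A.
  by rewrite !mulr_ge0 ?Phibar_ge0// addr_ge0 ?mulr_ge0 ?invr_ge0 ?mulr_ge0
    ?Phibar_ge0 ?exprn_ge0.
(* After [A] is dropped, what remains is $2 \le (\kappa + 3)n$, true for $n \ge 1$. *)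
apply: ler_wpDl => //; rewrite mulrA ler_pM2r ?invr_gt0 ?exprn_gt0 ?ltr0n//.
have := ler_wpM2l kappa0 n1; lra.
Unshelve. all: by end_near.
Qed.
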